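(* Let $q\in(0,1)$. Then, for $\tau=312$ and for $\tau=231$, $$\frac{2q^2(1-q)(1-q^3)}{1-q^4-\sqrt{(1-q^4)^2-4q^2(1-q)(1-q^3)}}<\lim_{n\to\infty}\big(P_n^q(S_n(\tau))\big)^{\frac1n}<\frac{2q^2(q^2+1)(1-q)}{1-\sqrt{1-4(1-q)q^2(q^2+1)}}.$$
   Context: $S_n$ is the set of permutations $\sigma=\sigma_1\cdots\sigma_n$ of $[n]=\{1,\dots,n\}$, where $\sigma_i=\sigma(i)$. For $\tau\in S_m$ with $2\le m\le n$, $\sigma\in S_n$ contains $\tau$ as a pattern if there are indices $1\le i_1<\cdots<i_m\le n$ such that for all $1\le j,k\le m$, $\sigma_{i_j}<\sigma_{i_k}$ if and only if $\tau_j<\tau_k$; otherwise $\sigma$ avoids $\tau$. $S_n(\tau)$ is the set of $\sigma\in S_n$ avoiding $\tau$ (and $S_n(\tau)=S_n$ if $m>n$). For $q>0$, the Mallows distribution with parameter $q$ is the probability measure on $S_n$ given by $P_n^q(\sigma)=q^{\mathrm{inv}(\sigma)}/Z_n(q)$, where $\mathrm{inv}(\sigma)$ is the number of inversions of $\sigma$, i.e. pairs $i<j$ with $\sigma_i>\sigma_j$, and $Z_n(q)=\sum_{\sigma\in S_n}q^{\mathrm{inv}(\sigma)}$, which for $q\neq 1$ equals $\prod_{k=1}^n\frac{1-q^k}{1-q}$. *)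

(* Defs.v *)
From mathcomp Require Import all_boot all_order all_fingroup all_algebra.
From mathcomp Require Import all_classical all_reals all_analysis.

Set Implicit Arguments.
Unset Strict Implicit.
Unset Printing Implicit Defensive.

Import Order.TTheory GRing.Theory Num.Theory.

Local Open Scope ring_scope.

(* Elements of 'S_n permute {0, ..., n-1}; one-line notation in the usual
   alphabet {1, ..., n} is obtained by shifting positions and values by one,
   which changes neither patterns nor inversions. *)
Definition oneline (n : nat) (s : 'S_n) : seq nat :=
  [seq (nat_of_ord (s i)).+1 | i <- enum 'I_n].

Definition perm312 : 'S_3 := perm (@ord_pred_inj 3).

Definition perm231 : 'S_3 := perm (@ordS_inj 3).

Lemma oneline_perm312 : oneline perm312 = [:: 3; 1; 2]%N.
Proof. by rewrite /oneline !enum_ordSl /= (size0nil (size_enum_ord 0)) /= !permE. Qed.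

Lemma oneline_perm231 : oneline perm231 = [:: 2; 3; 1]%N.
Proof. by rewrite /oneline !enum_ordSl /= (size0nil (size_enum_ord 0)) /= !permE. Qed.

(* The function f lists the positions i_1 < ... < i_m of an occurrence. *)
Definition contains_pattern (m n : nat) (tau : 'S_m) (s : 'S_n) : bool :=
  [exists f : {ffun 'I_m -> 'I_n},
    [forall j : 'I_m, forall k : 'I_m, (j < k)%N ==> (f j < f k)%N] &&
    [forall j : 'I_m, forall k : 'I_m,
       (s (f j) < s (f k))%N == (tau j < tau k)%N]].

Definition avoiders (n m : nat) (tau : 'S_m) : {set 'S_n} :=
  [set s : 'S_n | ~~ contains_pattern tau s].

Definition inversions (n : nat) (s : 'S_n) : nat :=
  #|[set p : 'I_n * 'I_n | (p.1 < p.2)%N && (s p.2 < s p.1)%N]|.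

Definition mallows_Z (R : realType) (n : nat) (q : R) : R :=
  \sum_(s : 'S_n) q ^+ inversions s.

Definition mallows (R : realType) (n : nat) (q : R) (A : {set 'S_n}) : R :=
  \sum_(s in A) q ^+ inversions s / mallows_Z n q.

(* Main.v *)
(* Splitting a 312-avoiding permutation of [n + 1] at its minimum, which sits at
   some position [i], gives a direct sum of 312-avoiding permutations of sizes
   [i] and [n - i]; the minimum itself creates [i] inversions.  Hence the weights
   [A_n] (sums of [q ^+ inv] over the avoiders) satisfy Carlitz' recurrence
   [A_(n+1) = \sum_i q^i A_i A_(n-i)], that is, [A(x) = 1 + x A(x) A(q x)] for
   the generating series.  Inversion of permutations exchanges 312 and 231.

   The recurrence makes [A_n] supermultiplicative, so [A_n^(1/n)] converges
   (Fekete), to [1 / r] with [r] the radius of convergence of [A]; moreover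
   [Z_n (1 - q)^n = \prod_(k <= n) (1 - q^k)] is bounded below, so the limit of
   the theorem is [(1 - q) / r].

   Upper bound on the limit: [A(x) = G(q x) / G(x)] with
   [G(x) = \sum_n (-1)^n q^(n(n-1)) x^n / ((1-q)...(1-q^n))].  The cubic truncation
   [H] of [G] satisfies [H(x) <= H(q x) - x H(q^2 x)], so the partial sums of [A]
   stay below [H(q x) / H(x)] as long as [H > 0], and [H] is positive slightly
   beyond the root of [1 - x/(1-q) + q^2 (1+q^2) x^2/(1-q)] that gives the bound.

   Lower bound: [r A(q r) = 1], and the bound is [(1 - q) / x] for the zero [x] of
   the continued fraction [1 - x/(1 - q x/(1 - q^2 x/(1 - q^3 x)))], obtained from
   [1 - x A(q x)] by replacing [A(q^4 x) > 1] by 1. *)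
Require Import Defs.
From mathcomp Require Import all_boot all_order all_fingroup all_algebra.
From mathcomp Require Import all_classical all_reals all_analysis.
From mathcomp Require Import zify ring lra.

Set Implicit Arguments.
Unset Strict Implicit.
Unset Printing Implicit Defensive.

Import Order.TTheory GRing.Theory Num.Theory.
Import numFieldNormedType.Exports.

Local Open Scope classical_set_scope.
Local Open Scope ring_scope.

(** * 312-avoiding permutations and inversions *)

Lemma contains_perm312P (n : nat) (s : 'S_n) :
  reflect (exists a b c : 'I_n, [/\ (a < b)%N, (b < c)%N,
             (s b < s c)%N & (s c < s a)%N])
          (contains_pattern perm312 s).
Proof.
apply: (iffP existsP) => [[f /andP[/forallP fmono /forallP fpat]]|].
  have mono (j k : 'I_3) : (j < k)%N -> (f j < f k)%N.
    by move=> jk; move/forallP/(_ k)/implyP: (fmono j); apply.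
  have pat (j k : 'I_3) : (perm312 j < perm312 k)%N -> (s (f j) < s (f k))%N.
    by move=> jk; move/forallP/(_ k)/eqP: (fpat j) => ->.
  exists (f (inord 0)), (f (inord 1)), (f (inord 2)).
  by split; [apply: mono|apply: mono|apply: pat|apply: pat];
    rewrite ?permE /= !inordK.
move=> [a [b [c [ab bc sbc sca]]]].
exists [ffun j : 'I_3 => if j == 0%N :> nat then a else if j == 1%N :> nat then b else c].
apply/andP; split; apply/forallP => j; apply/forallP => k; rewrite !ffunE.
  by apply/implyP; case: j => [[|[|[|j]]] //= _]; case: k => [[|[|[|k]]] //= _] _; lia.
rewrite !permE.
by apply/eqP; case: j => [[|[|[|j]]] //= _]; case: k => [[|[|[|k]]] //= _];
  rewrite /modn /=; lia.
Qed.

Lemma contains_perm231P (n : nat) (s : 'S_n) :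
  reflect (exists a b c : 'I_n, [/\ (a < b)%N, (b < c)%N,
             (s c < s a)%N & (s a < s b)%N])
          (contains_pattern perm231 s).
Proof.
apply: (iffP existsP) => [[f /andP[/forallP fmono /forallP fpat]]|].
  have mono (j k : 'I_3) : (j < k)%N -> (f j < f k)%N.
    by move=> jk; move/forallP/(_ k)/implyP: (fmono j); apply.
  have pat (j k : 'I_3) : (perm231 j < perm231 k)%N -> (s (f j) < s (f k))%N.
    by move=> jk; move/forallP/(_ k)/eqP: (fpat j) => ->.
  exists (f (inord 0)), (f (inord 1)), (f (inord 2)).
  by split; [apply: mono|apply: mono|apply: pat|apply: pat];
    rewrite ?permE /= !inordK.
move=> [a [b [c [ab bc sca sab]]]].
exists [ffun j : 'I_3 => if j == 0%N :> nat then a else if j == 1%N :> nat then b else c].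
apply/andP; split; apply/forallP => j; apply/forallP => k; rewrite !ffunE.
  by apply/implyP; case: j => [[|[|[|j]]] //= _]; case: k => [[|[|[|k]]] //= _] _; lia.
rewrite !permE.
by apply/eqP; case: j => [[|[|[|j]]] //= _]; case: k => [[|[|[|k]]] //= _];
  rewrite /modn /=; lia.
Qed.

Lemma contains_perm231V (n : nat) (s : 'S_n) :
  contains_pattern perm231 s^-1%g = contains_pattern perm312 s.
Proof.
apply/contains_perm231P/contains_perm312P => [[a [b [c [ab bc sca sab]]]]|].
  by exists (s^-1 c)%g, (s^-1 a)%g, (s^-1 b)%g; rewrite !permKV; split.
move=> [a [b [c [ab bc sbc sca]]]].
by exists (s b), (s c), (s a); rewrite !permK; split.
Qed.

Lemma inversionsE (n : nat) (s : 'S_n) :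
  inversions s = (\sum_(i < n) \sum_(j < n) ((i < j) && (s j < s i)))%N.
Proof.
rewrite /inversions -sum1_card pair_big /= [RHS]big_mkcond /= [LHS]big_mkcond /=.
by apply: eq_bigr => -[i j] _; rewrite inE /=; case: ifP.
Qed.

Lemma inversionsV (n : nat) (s : 'S_n) : inversions s^-1%g = inversions s.
Proof.
rewrite !inversionsE exchange_big [RHS](reindex_inj (@perm_inj _ s^-1%g)) /=.
apply: eq_bigr => i _; rewrite [RHS](reindex_inj (@perm_inj _ s^-1%g)) /=.
by apply: eq_bigr => j _; rewrite !permKV andbC.
Qed.

(** [lift_perm i ord0 s] inserts a new minimum at position [i]; it is inverted exactly with the [i]
    entries before it. *)
Lemma inversions_lift_perm (n : nat) (i : 'I_n.+1) (s : 'S_n) :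
  inversions (lift_perm i ord0 s) = (i + inversions s)%N.
Proof.
rewrite !inversionsE (bigD1_ord i) //= big1 ?add0n; last first.
  by move=> j _; rewrite lift_perm_id ltn0 andbF.
under eq_bigr => j _ do rewrite (bigD1_ord i) //= lift_perm_id lift_perm_lift.
rewrite big_split /=; congr addn.
  transitivity (\sum_(j < n | (j < i)%N) 1)%N.
    rewrite [RHS]big_mkcond; apply: eq_bigr => j _ /=.
    have -> : (lift i j < i)%N = (j < i)%N.
      by rewrite /= /bump; case: (leqP i j) => /=; lia.
    by case: ifP.
  by rewrite -(big_ord_widen n (fun=> 1%N)) ?sum1_card ?card_ord ?leq_ord.
apply: eq_bigr => j _; apply: eq_bigr => k _.
rewrite !lift_perm_lift /= /bump; congr (nat_of_bool _).
by case: (leqP i j); case: (leqP i k); lia.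
Qed.

Lemma lift_perm_inj2 (n : nat) (j : 'I_n.+1) :
  injective (fun p : 'I_n.+1 * 'S_n => lift_perm p.1 j p.2).
Proof.
move=> [i s] [i' s'] /= e.
have ii' : i = i'.
  by apply: (@perm_inj _ (lift_perm i' j s')); rewrite -{1}e !lift_perm_id.
subst i'; congr pair; apply/permP => k; apply: (@lift_inj _ j).
by rewrite -!(lift_perm_lift i) e.
Qed.

(** Inserting the minimum is injective, hence bijective because [(n+1) * n! = (n+1)!]. *)
Lemma sum_lift_perm (V : nmodType) (n : nat) (P : pred 'S_n.+1) (F : 'S_n.+1 -> V) :
  \sum_(s | P s) F s =
  \sum_(i < n.+1) \sum_(s : 'S_n | P (lift_perm i ord0 s)) F (lift_perm i ord0 s).
Proof.
rewrite pair_big_dep /= (reindex (fun p => lift_perm p.1 ord0 p.2)) //=.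
apply: onW_bij; apply: inj_card_bij; first exact: lift_perm_inj2.
by rewrite card_prod !card_Sn card_ord -factS.
Qed.

(** The new minimum can only play the 1 of a 312, so the new occurrences come from pairs in
    decreasing order on either side of position [i]. *)
Lemma avoid312_lift_perm (n : nat) (i : 'I_n.+1) (s : 'S_n) :
  ~~ contains_pattern perm312 (lift_perm i ord0 s) =
  ~~ contains_pattern perm312 s &&
  [forall a : 'I_n, forall b : 'I_n, (a < i <= b)%N ==> (s a < s b)%N].
Proof.
apply: negb_inj; rewrite negb_and !negbK.
apply/contains_perm312P/orP.
  move=> [x [y [z [xy yz]]]].
  case: (unliftP i z) => [z' ez|->]; last by rewrite lift_perm_id.
  case: (unliftP i x) => [x' ex|->]; last by rewrite lift_perm_id.
  case: (unliftP i y) => [y' ey|ey]; last first.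
    move: xy yz; rewrite ez ex ey !lift_perm_lift lift_perm_id /= /bump !leq0n.
    move=> xy yz _ szx.
    right; rewrite negb_forall; apply/existsP; exists x'.
    rewrite negb_forall; apply/existsP; exists z'; rewrite negb_imply.
    lia.
  move: xy yz; rewrite ez ex ey !lift_perm_lift /= /bump !leq0n => xy yz syz szx.
  left; apply/contains_perm312P; exists x', y', z'.
  by split; lia.
case=> [/contains_perm312P[a [b [c [ab bc sbc sca]]]]|].
  exists (lift i a), (lift i b), (lift i c); rewrite !lift_perm_lift /= /bump.
  by split; rewrite /= ?ltnS //; lia.
rewrite negb_forall => /existsP[a]; rewrite negb_forall => /existsP[b].
rewrite negb_imply -leqNgt [(s b <= _)%N]leq_eqVlt.
move=> /andP[/andP[ai ib] /orP[/eqP e|sba]].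
  by move: (ord_inj e) => /perm_inj e'; move: ai ib; rewrite e'; lia.
exists (lift i a), i, (lift i b); rewrite !lift_perm_lift lift_perm_id /= /bump.
by split; rewrite /= ?ltnS //; lia.
Qed.

(** * Direct sums of permutations *)

Section DirectSum.
Variables m k : nat.

Definition dsum_fun (s : 'S_m) (t : 'S_k) (i : 'I_(m + k)) : 'I_(m + k) :=
  match fintype.split i with inl a => lshift k (s a) | inr b => rshift m (t b) end.

Lemma dsum_funl s t a : dsum_fun s t (lshift k a) = lshift k (s a).
Proof. by rewrite /dsum_fun (unsplitK (inl a)). Qed.

Lemma dsum_funr s t b : dsum_fun s t (rshift m b) = rshift m (t b).
Proof. by rewrite /dsum_fun (unsplitK (inr b)). Qed.

Lemma dsum_fun_inj s t : injective (dsum_fun s t).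
Proof.
move=> i j; case: (split_ordP i) => a ->; case: (split_ordP j) => b ->;
rewrite ?dsum_funl ?dsum_funr => /eqP; rewrite ?eq_lrshift ?eq_rlshift //.
  by rewrite eq_lshift => /eqP/perm_inj->.
by rewrite eq_rshift => /eqP/perm_inj->.
Qed.

Definition dsum (s : 'S_m) (t : 'S_k) : 'S_(m + k) := perm (@dsum_fun_inj s t).

Lemma dsuml s t a : dsum s t (lshift k a) = lshift k (s a).
Proof. by rewrite permE dsum_funl. Qed.

Lemma dsumr s t b : dsum s t (rshift m b) = rshift m (t b).
Proof. by rewrite permE dsum_funr. Qed.

Lemma dsum_inj : injective (fun p : 'S_m * 'S_k => dsum p.1 p.2).
Proof.
move=> [s t] [s' t'] /= e; congr pair; apply/permP => i.
  by apply: (@lshift_inj m k); rewrite -(dsuml s t) e dsuml.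
by apply: (@rshift_inj m k); rewrite -(dsumr s t) e dsumr.
Qed.

Lemma inversions_dsum s t :
  inversions (dsum s t) = (inversions s + inversions t)%N.
Proof.
rewrite !inversionsE big_split_ord /=; congr addn; apply: eq_bigr => a _;
  rewrite big_split_ord /=.
  rewrite [X in (_ + X)%N]big1 ?addn0; last first.
    move=> b _; rewrite dsuml dsumr /= ltnNge ltnNge.
    by have := ltn_ord (s a); lia.
  by apply: eq_bigr => b _; rewrite !dsuml.
rewrite big1 ?add0n; last first.
  by move=> b _; rewrite dsuml dsumr /=; have := ltn_ord b; lia.
by apply: eq_bigr => b _; rewrite !dsumr /= !ltn_add2l.
Qed.

(** 312 is not itself a direct sum, so no occurrence meets both blocks. *)
Lemma contains312_dsum s t :
  contains_pattern perm312 (dsum s t) =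
  contains_pattern perm312 s || contains_pattern perm312 t.
Proof.
apply/contains_perm312P/orP => [[x [y [z []]]]|].
  case: (split_ordP x) => a ->; case: (split_ordP z) => c ->;
  case: (split_ordP y) => b ->; rewrite !(dsuml, dsumr) /= => xy yz syz szx.
  - by left; apply/contains_perm312P; exists a, b, c.
  - by have := ltn_ord c; lia.
  - by have := ltn_ord (s a); lia.
  - by have := ltn_ord (s a); lia.
  - by have := ltn_ord b; lia.
  - by have := ltn_ord c; lia.
  - by have := ltn_ord b; lia.
  - right; apply/contains_perm312P; exists a, b, c.
    by rewrite !ltn_add2l in xy yz syz szx.
case=> /contains_perm312P[a [b [c [ab bc sbc sca]]]].
  by exists (lshift k a), (lshift k b), (lshift k c); rewrite !dsuml.
by exists (rshift m a), (rshift m b), (rshift m c); rewrite !dsumr /= !ltn_add2l.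
Qed.

Lemma dsum_image (s : 'S_(m + k)) :
  (s \in (fun p : 'S_m * 'S_k => dsum p.1 p.2) @: [set: _]%SET) =
  [forall a : 'I_(m + k), forall b : 'I_(m + k), (a < m <= b)%N ==> (s a < s b)%N].
Proof.
apply/imsetP/idP => [[[t u] _ ->]|/forallP sP].
  apply/forallP => a; apply/forallP => b; apply/implyP.
  case: (split_ordP a) => a' ->; case: (split_ordP b) => b' ->;
    rewrite !(dsuml, dsumr) /=.
  - by have := ltn_ord b'; lia.
  - by have := ltn_ord (t a'); lia.
  - by lia.
  - by lia.
have {}sP (a b : 'I_(m + k)) : (a < m <= b)%N -> (s a < s b)%N.
  by move=> amb; move/forallP/(_ b)/implyP: (sP a); apply.
(* A single value at least [m] at the first [m] positions pushes all later values to at least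
   [m]. *)
have big (b : 'I_k) (a : 'I_m) (c : 'I_k) :
    s (lshift k a) = rshift m c -> (m <= s (rshift m b))%N.
  move=> e; have /= := sP (lshift k a) (rshift m b); rewrite e /=.
  by rewrite ltn_ord leq_addr => /(_ isT); lia.
have sl a : exists c, s (lshift k a) = lshift k c.
  case: (split_ordP (s (lshift k a))) => c e; first by exists c.
  (* pigeonhole: the k+1 entries at [a] and at positions >= m all have values >= m *)
  pose g (o : option 'I_k) := s (if o is Some b then rshift m b else lshift k a).
  have gP o : exists d, g o = rshift m d.
    case: o => [b|] /=; last by exists c.
    rewrite /g; case: (split_ordP (s (rshift m b))) => d ed; last by exists d.
    by have := big b a c e; rewrite ed /= leqNgt ltn_ord.
  have [h hP] := fin_all_exists gP.
  have hinj : injective h.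
    move=> o o' eh; have : g o = g o' by rewrite !hP eh.
    move/perm_inj => /eqP; case: o {eh} => [b|]; case: o' => [b'|] //;
    rewrite ?eq_lrshift ?eq_rlshift // eq_rshift => /eqP -> //.
  by have := leq_card h hinj; rewrite card_option card_ord ltnn.
have [f fP] := fin_all_exists sl.
have finj : injective f.
  by move=> a b e; apply: (@lshift_inj m k); apply: (@perm_inj _ s); rewrite !fP e.
(* The injection [f] of ['I_m] is onto, so every value below [m] is already taken by the first
   block. *)
have sr b : exists c, s (rshift m b) = rshift m c.
  case: (split_ordP (s (rshift m b))) => c e; last by exists c.
  have := fP (invF finj c); rewrite f_invF -e => /perm_inj/eqP.
  by rewrite eq_lrshift.
have [g gP] := fin_all_exists sr.
have ginj : injective g.
  by move=> a b e; apply: (@rshift_inj m k); apply: (@perm_inj _ s); rewrite !gP e.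
exists (perm finj, perm ginj) => //; apply/permP => i.
by case: (split_ordP i) => j ->; rewrite (dsuml, dsumr) permE.
Qed.

End DirectSum.

(** * Inversion-weighted counts of avoiders *)

Section Weights.
Variables (R : comNzRingType) (q : R).

Definition avoid_weight (n : nat) : R :=
  \sum_(s in avoiders n perm312) q ^+ inversions s.

Lemma avoid_weight231 n :
  \sum_(s in avoiders n perm231) q ^+ inversions s = avoid_weight n.
Proof.
rewrite /avoid_weight (reindex_inj (@invg_inj _)) /=.
apply: eq_big => s; first by rewrite !inE contains_perm231V.
by rewrite inversionsV.
Qed.

Lemma avoid_weight0 : avoid_weight 0 = 1.
Proof.
rewrite /avoid_weight (bigD1 1%g) /=; last first.
  by rewrite inE; apply/contains_perm312P => -[[]].
rewrite big1 ?addr0; first by rewrite inversionsE big_ord0 expr0.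
by move=> s /andP[_ /negP]; case; apply/eqP/permP => -[].
Qed.

(** The size is a separate [n] tied by an equation: [i + (n - i)] is not convertible to [n], and
    casts between permutation types are avoided this way. *)
Lemma sum_dsum (m k n : nat) : n = (m + k)%N ->
  \sum_(s : 'S_n | ~~ contains_pattern perm312 s &&
     [forall a : 'I_n, forall b : 'I_n, (a < m <= b)%N ==> (s a < s b)%N])
     q ^+ inversions s = avoid_weight m * avoid_weight k.
Proof.
move=> ->; under eq_bigl => s do rewrite -dsum_image andbC.
rewrite /avoid_weight big_distrlr /= pair_big /=.
rewrite big_imset_cond /=; last by move=> ? ? _ _; exact: dsum_inj.
apply: eq_big => [[s t]|[s t] _] /=; last by rewrite inversions_dsum exprD.
by rewrite !inE contains312_dsum negb_or.
Qed.

Lemma avoid_weightS n :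
  avoid_weight n.+1 = \sum_(i < n.+1) q ^+ i * (avoid_weight i * avoid_weight (n - i)).
Proof.
rewrite {1}/avoid_weight sum_lift_perm; apply: eq_bigr => i _.
rewrite -(@sum_dsum i (n - i) n) ?(subnKC (leq_ord i)) //.
rewrite big_distrr /=; apply: eq_big => s; first by rewrite inE avoid312_lift_perm.
by rewrite inversions_lift_perm exprD.
Qed.

Lemma mallows_sumS n :
  \sum_(s : 'S_n.+1) q ^+ inversions s =
  (\sum_(i < n.+1) q ^+ i) * \sum_(s : 'S_n) q ^+ inversions s.
Proof.
rewrite sum_lift_perm big_distrl; apply: eq_bigr => i _ /=.
by rewrite big_distrr; apply: eq_bigr => s _; rewrite inversions_lift_perm exprD.
Qed.

End Weights.

(** * The Carlitz recurrence *)

Lemma sum_triangle (V : nmodType) (F : nat -> nat -> V) (n : nat) :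
  \sum_(k < n) \sum_(i < k.+1) F i (k - i)%N = \sum_(i < n) \sum_(j < n - i) F i j.
Proof.
elim: n => [|n IHn]; first by rewrite !big_ord0.
rewrite big_ord_recr /= IHn [RHS]big_ord_recr /= subSnn big_ord1.
under [in RHS]eq_bigr => i _ do
  rewrite subSn ?(ltnW (ltn_ord i)) // big_ord_recr /=.
by rewrite big_split /= [X in _ + X]big_ord_recr /= subnn addrA.
Qed.

Lemma ler_sum_widen (R : numDomainType) (F : nat -> R) (m n : nat) :
  (forall i, 0 <= F i) -> (m <= n)%N -> \sum_(i < m) F i <= \sum_(i < n) F i.
Proof.
move=> F0 mn; rewrite -[n](subnKC mn) big_split_ord /= lerDl.
by apply: sumr_ge0 => i _; exact: F0.
Qed.

Section CarlitzRecurrence.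
Variables (R : realType) (q : R) (a : nat -> R).
Hypotheses (q_gt0 : 0 < q) (q_lt1 : q < 1) (a0 : a 0 = 1).
Hypothesis aS : forall n, a n.+1 = \sum_(i < n.+1) q ^+ i * (a i * a (n - i)%N).

Lemma carlitz_ge0 n : 0 <= a n.
Proof.
elim/ltn_ind: n => -[|n] IHn; first by rewrite a0.
rewrite aS; apply: sumr_ge0 => i _.
by rewrite !mulr_ge0 ?exprn_ge0 ?(ltW q_gt0) ?IHn // ltnS leq_subr.
Qed.

Lemma carlitz_ge1 n : 1 <= a n.
Proof.
elim: n => [|n IHn]; first by rewrite a0.
apply: (le_trans IHn); rewrite aS big_ord_recl expr0 mul1r a0 mul1r subn0 lerDl.
by apply: sumr_ge0 => i _; rewrite !mulr_ge0 ?exprn_ge0 ?carlitz_ge0 ?(ltW q_gt0).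
Qed.

(** Induction on [m]: multiplying the recurrence for [a m.+1] by [a n] and absorbing [a n] into the
    second factor gives the first [m.+1] terms of the recurrence for [a (m + n).+1]. *)
Lemma carlitz_supermul m n : a m * a n <= a (m + n)%N.
Proof.
elim/ltn_ind: m => -[|m] IHm; first by rewrite a0 mul1r.
rewrite addSn !aS big_distrl /=.
have F0 i : 0 <= q ^+ i * (a i * a (m + n - i)%N).
  by rewrite !mulr_ge0 ?exprn_ge0 ?carlitz_ge0 ?(ltW q_gt0).
apply: le_trans (ler_sum_widen F0 (_ : m.+1 <= (m + n).+1)%N); last first.
  by rewrite ltnS leq_addr.
apply: ler_sum => i _; rewrite -!mulrA.
rewrite ler_wpM2l ?exprn_ge0 ?(ltW q_gt0) // ler_wpM2l ?carlitz_ge0 //.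
by rewrite -addnBAC ?leq_ord // IHm // ltnS leq_subr.
Qed.

(** * Partial sums of the generating series *)

Definition psum (N : nat) (x : R) : R := \sum_(n < N) a n * x ^+ n.

Lemma psum_ge0 N x : 0 <= x -> 0 <= psum N x.
Proof.
by move=> x0; apply: sumr_ge0 => i _; rewrite mulr_ge0 ?carlitz_ge0 ?exprn_ge0.
Qed.

(** Truncated form of [A(x) = 1 + x A(q x) A(x)]: the product runs over the triangle [i + j < N],
    which the next two lemmas compare with a square containing it and a rectangle inside it. *)
Lemma psumS N x : psum N.+1 x =
  1 + x * \sum_(i < N) \sum_(j < N - i) a i * (q * x) ^+ i * (a j * x ^+ j).
Proof.
rewrite /psum big_ord_recl a0 expr0 mulr1; congr (_ + _).
rewrite -(sum_triangle (fun i j => a i * (q * x) ^+ i * (a j * x ^+ j))).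
rewrite big_distrr /=; apply: eq_bigr => n _ /=.
rewrite aS exprS big_distrl big_distrr /=; apply: eq_bigr => i _.
rewrite -[X in x * x ^+ X](subnKC (leq_ord i)) exprD exprMn.
by ring.
Qed.

Lemma psum_le N x : 0 <= x -> psum N.+1 x <= 1 + x * (psum N (q * x) * psum N x).
Proof.
move=> x0; rewrite psumS lerD2l ler_wpM2l // big_distrlr /=.
have qx0 : 0 <= q * x by rewrite mulr_ge0 // ltW.
apply: ler_sum => i _.
apply: (ler_sum_widen (F := fun j => _ * (a j * x ^+ j))) (leq_subr _ _).
by move=> j; rewrite !mulr_ge0 ?carlitz_ge0 ?exprn_ge0.
Qed.

Lemma psum_ge M N x : 0 <= x ->
  1 + x * (psum M (q * x) * psum N x) <= psum (M + N).+1 x.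
Proof.
move=> x0; rewrite psumS lerD2l ler_wpM2l // big_distrlr /=.
have qx0 : 0 <= q * x by rewrite mulr_ge0 // ltW.
have F0 i j : 0 <= a i * (q * x) ^+ i * (a j * x ^+ j).
  by rewrite !mulr_ge0 ?carlitz_ge0 ?exprn_ge0.
apply: (@le_trans _ _
  (\sum_(i < M) \sum_(j < M + N - i) a i * (q * x) ^+ i * (a j * x ^+ j))).
  apply: ler_sum => i _.
  apply: (ler_sum_widen (F := fun j => a i * (q * x) ^+ i * (a j * x ^+ j))) => //.
  by have := ltn_ord i; lia.
apply: (ler_sum_widen (F := fun i =>
  \sum_(j < M + N - i) a i * (q * x) ^+ i * (a j * x ^+ j))).
  by move=> i; apply: sumr_ge0.
exact: leq_addr.
Qed.

(** A subsolution [H] of the linear q-difference equation makes [H (q * y) / H y] a supersolution of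
    the quadratic one. The induction treats all points [q ^+ k * x] at once, since the bound at [y]
    uses the one at [q * y]. *)
Lemma psum_supersolution (H : R -> R) (x : R) : 0 <= x ->
  (forall k, 0 < H (q ^+ k * x)) ->
  (forall y, 0 <= y -> H y <= H (q * y) - y * H (q * (q * y))) ->
  forall N k, psum N (q ^+ k * x) <= H (q ^+ k.+1 * x) / H (q ^+ k * x).
Proof.
move=> x0 Hpos Hsub; elim=> [|N IHN] k.
  by rewrite /psum big_ord0 divr_ge0 ?ltW.
set y := q ^+ k * x.
have y0 : 0 <= y by rewrite mulr_ge0 ?exprn_ge0 ?(ltW q_gt0).
have yS : q * y = q ^+ k.+1 * x by rewrite exprS mulrA.
have ySS : q * (q * y) = q ^+ k.+2 * x by rewrite yS [in RHS]exprS mulrA.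
apply: (le_trans (psum_le N y0)).
have h1 := IHN k; have h2 := IHN k.+1.
rewrite -ySS -yS -/y in h1 h2 *.
have qy0 : 0 <= q * y by rewrite mulr_ge0 // ltW.
have H0 : 0 < H y by exact: Hpos.
have H1 : 0 < H (q * y) by rewrite yS; exact: Hpos.
(* The two quotients telescope: [H (q * y)] cancels. *)
have := ler_pM (psum_ge0 N qy0) (psum_ge0 N y0) h2 h1.
rewrite [leRHS]mulrA divfK ?gt_eqF // => h3.
apply: (@le_trans _ _ (1 + y * (H (q * (q * y)) / H y))).
  by rewrite lerD2l ler_wpM2l.
rewrite ler_pdivlMr // mulrDl mul1r -[y * _ * _]mulrA divfK ?gt_eqF //.
by have := Hsub _ y0; lra.
Qed.

Lemma carlitz_le_of_supersolution (H : R -> R) (x : R) : 0 <= x ->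
  (forall k, 0 < H (q ^+ k * x)) ->
  (forall y, 0 <= y -> H y <= H (q * y) - y * H (q * (q * y))) ->
  forall n, a n * x ^+ n <= H (q * x) / H x.
Proof.
move=> x0 Hpos Hsub n.
have := psum_supersolution x0 Hpos Hsub n.+1 0; rewrite expr0 expr1 mul1r.
apply: le_trans; rewrite /psum big_ord_recr /= lerDr.
exact: (psum_ge0 n).
Qed.

(** Keeping only the first [K] terms of the recurrence bounds [a n * x ^+ n] below by a combination
    of the [K] preceding values with total weight at least 1, so a lower bound on the initial values
    persists. *)
Lemma carlitz_ge_of_renewal (K : nat) (x : R) : 0 < x ->
  1 <= \sum_(k < K) q ^+ k * a k * x ^+ k.+1 ->
  exists2 c, 0 < c & forall n, c <= a n * x ^+ n.
Proof.
move=> x0 K1.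
(* This lies below [x ^+ n] for every [n <= K], and [a n >= 1]. *)
pose c := Num.min 1 x ^+ K.
have m0 : 0 < Num.min 1 x by rewrite lt_min ltr01.
have c0 : 0 < c by rewrite exprn_gt0.
exists c => //; elim/ltn_ind => n IHn.
have [nK|Kn] := leqP n K.
  apply: (@le_trans _ _ (1 * x ^+ n)); last first.
    by rewrite ler_wpM2r ?carlitz_ge1 ?exprn_ge0 ?ltW.
  rewrite mul1r /c -(subnKC nK) exprD -[leRHS]mulr1.
  apply: ler_pM; rewrite ?exprn_ge0 ?(ltW m0) //.
    by rewrite lerXn2r ?nnegrE ?(ltW m0) ?(ltW x0) // ge_min lexx orbT.
  by rewrite exprn_ile1 ?(ltW m0) // ge_min lexx.
case: n IHn Kn => // n IHn; rewrite ltnS => Kn.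
have F0 i : 0 <= q ^+ i * (a i * a (n - i)%N) * x ^+ n.+1.
  by rewrite !mulr_ge0 ?exprn_ge0 ?carlitz_ge0 ?ltW.
rewrite aS big_distrl /=.
apply: le_trans (ler_sum_widen F0 (leqW Kn)).
rewrite -[leLHS]mul1r; apply: (le_trans (ler_wpM2r (ltW c0) K1)).
rewrite big_distrl /=; apply: ler_sum => i _.
have ni : (i <= n)%N by apply: leq_trans Kn; exact: ltnW.
apply: (@le_trans _ _ (q ^+ i * a i * x ^+ i.+1 * (a (n - i)%N * x ^+ (n - i)))).
  by rewrite ler_wpM2l ?IHn ?mulr_ge0 ?exprn_ge0 ?carlitz_ge0 ?ltW // ltnS leq_subr.
have -> : x ^+ n.+1 = x ^+ i.+1 * x ^+ (n - i) by rewrite -exprD addSn subnKC.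
by rewrite le_eqVlt; apply/orP; left; apply/eqP; ring.
Qed.

(* Junk value if the partial sums at [x] are unbounded. *)
Definition genseries (x : R) : R := limn (psum^~ x).

Lemma nondecreasing_psum x : 0 <= x -> nondecreasing_seq (psum^~ x).
Proof.
move=> x0 m n mn; apply: (ler_sum_widen (F := fun n => a n * x ^+ n)) => // i.
by rewrite mulr_ge0 ?carlitz_ge0 ?exprn_ge0.
Qed.

Lemma cvg_psum x B : 0 <= x -> (forall N, psum N x <= B) -> cvgn (psum^~ x).
Proof.
move=> x0 xB; apply: nondecreasing_is_cvgn; first exact: nondecreasing_psum.
by exists B => _ [N _ <-].
Qed.

(** Limit of [psum_ge] with [M = N]; the bound at [x] also gives convergence at [q * x]. *)
Lemma genseries_ge x B : 0 <= x -> (forall N, psum N x <= B) ->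
  1 + x * (genseries (q * x) * genseries x) <= genseries x.
Proof.
move=> x0 xB.
have qx0 : 0 <= q * x by rewrite mulr_ge0 // ltW.
have cx := cvg_psum x0 xB.
have cqx : cvgn (psum^~ (q * x)).
  apply: (cvg_psum (B := B)) => // N; apply: le_trans (xB N).
  apply: ler_sum => i _; rewrite ler_wpM2l ?carlitz_ge0 // lerXn2r ?nnegrE //.
  by rewrite ler_piMl // ltW.
have h : (fun N => 1 + x * (psum N (q * x) * psum N x)) @ \oo -->
    1 + x * (genseries (q * x) * genseries x).
  apply: cvgD; first exact: cvg_cst.
  by apply: cvgM; [exact: cvg_cst|exact: cvgM].
rewrite -(cvg_lim _ h) //; apply: limr_le; first by apply/cvg_ex; eexists; exact: h.
near=> N => /=.
apply: le_trans (psum_ge N N x0) _.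
exact: (nondecreasing_cvgn_le (nondecreasing_psum x0) cx).
Unshelve. all: by end_near. Qed.

Lemma genseries_ge_psum x B N : 0 <= x -> (forall N, psum N x <= B) ->
  psum N x <= genseries x.
Proof.
move=> x0 xB.
exact: (nondecreasing_cvgn_le (nondecreasing_psum x0) (cvg_psum x0 xB)).
Qed.

End CarlitzRecurrence.

(** * Growth rates *)

(** Fekete's lemma: the limit is the supremum of the [w n / n]. *)
Lemma superadditive_cvg (R : realType) (w : nat -> R) (r : R) :
  (forall m n, w m + w n <= w (m + n)%N) -> (forall n, w n <= n%:R * r) ->
  exists s : R, [/\ (fun n => w n / n%:R) @ \oo --> s,
    (forall n, w n <= n%:R * s) &
    (forall t, (forall n, w n <= n%:R * t) -> s <= t)].
Proof.
move=> wD wr.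
(* The shift to [n.+1] keeps the junk quotient by 0 out of the supremum. *)
pose E := range (fun n => w n.+1 / n.+1%:R).
have n0 n : 0 < n.+1%:R :> R by [].
have Eub t : (forall n, w n <= n%:R * t) -> ubound E t.
  by move=> wt _ [n _ <-]; rewrite ler_pdivrMr // mulrC.
have E0 : E !=set0 by exists (w 1 / 1%:R), 0.
have supE : has_sup E by split=> //; exists r; exact: Eub.
have ws n : w n <= n%:R * sup E.
  case: n => [|n]; first by rewrite mul0r; have := wr 0; rewrite mul0r.
  rewrite mulrC -ler_pdivrMr //; apply: ub_le_sup; first by case: supE.
  by exists n.
exists (sup E); split=> //; last by move=> t /Eub; exact: ge_sup.
apply/cvgrPdist_le => e e0.
have e2 : 0 < e / 2 by rewrite divr_gt0.
have [_ [N _ <-] wN] := sup_adherent e2 supE.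
set al := w N.+1 / N.+1%:R in wN.
(* Uniform bound on the error due to the remainder of [n] modulo [N.+1]. *)
pose B := \sum_(t < N.+1) `|w t - t%:R * al|.
have wdN d t : d%:R * w N.+1 + w t <= w (d * N.+1 + t)%N.
  elim: d => [|d IHd]; first by rewrite !mul0r !add0r mul0n add0n.
  rewrite mulSn -addnA -natr1 mulrDl mul1r.
  by have := wD N.+1 (d * N.+1 + t)%N; lra.
have wal n : n%:R * al - B <= w n.
  have nE := divn_eq n N.+1; have tN := ltn_pmod n (ltn0Sn N).
  have := wdN (n %/ N.+1)%N (n %% N.+1)%N; rewrite -nE.
  have -> : w N.+1 = N.+1%:R * al by rewrite mulrC divfK.
  have BE : `|w (n %% N.+1)%N - (n %% N.+1)%:R * al| <= B.
    rewrite /B (bigD1 (Ordinal tN)) //= lerDl.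
    by apply: sumr_ge0 => i _; exact: normr_ge0.
  have := ler_norm (- (w (n %% N.+1)%N - (n %% N.+1)%:R * al)); rewrite normrN.
  rewrite [in n%:R](nE) natrD natrM mulrDl mulrA.
  by lra.
near=> n.
have npos : 0 < n%:R :> R by rewrite ltr0n; near: n; exact: nbhs_infty_gt.
have nB : 2 * B / e <= n%:R by near: n; exact: nbhs_infty_ger.
rewrite ger0_norm; last by rewrite subr_ge0 ler_pdivrMr // mulrC.
rewrite lerBlDr -lerBlDl ler_pdivlMr //.
apply: le_trans (wal n); rewrite ler_pdivrMr // in nB.
have : n%:R * (sup E - e / 2) <= n%:R * al by rewrite ler_pM2l // ltW.
by lra.
Unshelve. all: by end_near. Qed.

Lemma le0_of_natmul_bounded (R : realType) (d B : R) :
  (forall n, n%:R * d <= B) -> d <= 0.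
Proof.
move=> dB; rewrite leNgt; apply/negP => d0.
have := truncnS_gt (B / d); rewrite ltr_pdivrMr // ltNge.
by rewrite dB.
Qed.

(** Fekete applied to [ln (v n)]; since [ln (D n)] stays bounded, the [n]-th root of [D n] tends to
    1. *)
Lemma supermultiplicative_root_cvg (R : realType) (v D : nat -> R) (C rho K : R) :
  (forall n, 0 < v n) -> (forall m n, v m * v n <= v (m + n)%N) ->
  0 < C -> 0 < rho -> (forall n, v n <= C * rho ^+ n) ->
  (forall n, 0 < D n <= 1) -> (forall n, - K <= ln (D n)) ->
  exists l : R, [/\ 0 < l, (fun n => (v n / D n) `^ (n%:R)^-1) @ \oo --> l,
    (forall n, v n <= l ^+ n) &
    (forall t B, 0 < t -> 0 < B -> (forall n, v n <= B * t ^+ n) -> l <= t)].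
Proof.
move=> v0 vM C0 rho0 vrho D01 DK.
have D0 n : 0 < D n by case/andP: (D01 n).
have wD m n : ln (v m) + ln (v n) <= ln (v (m + n)%N).
  by rewrite -lnM ?posrE // ler_ln ?posrE ?mulr_gt0.
have wX m n : n%:R * ln (v m) <= ln (v (n * m)%N) - ln (v 0).
  elim: n => [|n IHn]; first by rewrite mul0r mul0n subrr.
  by rewrite mulSn -natr1 mulrDl mul1r; have := wD m (n * m)%N; lra.
(* The constant [B] is removed by using the bound at [k * n] and letting [k] grow. *)
have wB t B : 0 < t -> 0 < B -> (forall n, v n <= B * t ^+ n) ->
    forall n, ln (v n) <= n%:R * ln t.
  move=> t0 B0 vt n.
  have vtn k : ln (v k) <= ln B + k%:R * ln t.
    rewrite mulr_natl -lnXn // -lnM ?posrE ?exprn_gt0 //.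
    by rewrite ler_ln ?posrE ?mulr_gt0 ?exprn_gt0.
  rewrite -subr_le0; apply: (@le0_of_natmul_bounded _ _ (ln B - ln (v 0))) => k.
  by have := wX n k; have := vtn (k * n)%N; rewrite natrM; lra.
have [s [ws sub slub]] := superadditive_cvg wD (wB _ _ rho0 C0 vrho).
exists (expR s); split.
- exact: expR_gt0.
- have DK0 : (fun n => - ln (D n) / n%:R) @ \oo --> (0 : R).
    have Kn : (fun n : nat => K / n%:R) @ \oo --> (0 : R).
      rewrite -(mulr0 K); apply: cvgM; first exact: cvg_cst.
      apply/gtr0_cvgV0; last exact: cvgr_idn.
      by near=> n; rewrite ltr0n; near: n; exact: nbhs_infty_gt.
    apply: (squeeze_cvgr _ (cvg_cst 0) Kn); near=> n.
    have npos : 0 < n%:R :> R by rewrite ltr0n; near: n; exact: nbhs_infty_gt.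
    have Dn : ln (D n) <= 0 by rewrite ln_le0 //; case/andP: (D01 n).
    rewrite divr_ge0 ?(ltW npos) ?oppr_ge0 //=.
    by rewrite ler_pM2r ?invr_gt0 //; have := DK n; lra.
  have sum_cvg : (fun n => ln (v n) / n%:R + - ln (D n) / n%:R) @ \oo --> s.
    by rewrite -[s]addr0; exact: cvgD.
  have exp_cvg : (fun n => expR (ln (v n) / n%:R + - ln (D n) / n%:R)) @ \oo --> expR s.
    by apply: continuous_cvg => //; exact: continuous_expR.
  apply: cvg_trans exp_cvg.
  apply: near_eq_cvg; near=> n => /=.
  by rewrite /powR (gt_eqF (divr_gt0 (v0 n) (D0 n))) ln_div ?posrE // -mulrDl mulrC.
- move=> n; rewrite -ler_ln ?posrE ?exprn_gt0 ?expR_gt0 // lnXn ?expR_gt0 // expRK.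
  by rewrite -mulr_natl.
move=> t B t0 B0 vt; rewrite -ler_ln ?posrE ?expR_gt0 // expRK; apply: slub.
exact: (wB _ B).
Unshelve. all: by end_near. Qed.

Lemma le_of_exp_bound (R : realType) (x y c : R) : 0 < x -> 0 < y -> 0 < c ->
  (forall n, c * x ^+ n <= y ^+ n) -> x <= y.
Proof.
move=> x0 y0 c0 cxy; rewrite -ler_ln ?posrE // -subr_le0.
apply: (@le0_of_natmul_bounded _ _ (- ln c)) => n.
have : ln (c * x ^+ n) <= ln (y ^+ n) by rewrite ler_ln ?posrE ?mulr_gt0 ?exprn_gt0.
rewrite lnM ?posrE ?exprn_gt0 // !lnXn // -!(mulr_natl (ln _)).
by lra.
Qed.

(* From [1 / (1 - y) = 1 + y / (1 - y) <= expR (y / (1 - q))] for [0 <= y <= q],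
   the sum of the [- ln (1 - q ^+ k)] is dominated by a geometric series. *)
Lemma ln_qpochhammer_ge (R : realType) (q : R) (n : nat) : 0 < q -> q < 1 ->
  - (1 - q)^-1 ^+ 2 <= ln (\prod_(k < n) (1 - q ^+ k.+1)).
Proof.
move=> q0 q1.
have d0 : 0 < 1 - q by rewrite subr_gt0.
have qk k : 0 < 1 - q ^+ k.+1 by rewrite subr_gt0 exprn_ilt1 // ltW.
have step y : 0 <= y -> y <= q -> - (y / (1 - q)) <= ln (1 - y).
  move=> y0 yq; have d' : 0 < 1 - y by lra.
  rewrite lerNl -lnV ?posrE // -ler_expR lnK ?posrE ?invr_gt0 //.
  have -> : (1 - y)^-1 = 1 + y / (1 - y) by field; lra.
  apply: (le_trans (expR_ge1Dx _)); rewrite ler_expR ler_wpM2l //.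
  by rewrite lef_pV2 ?posrE //; lra.
(* The induction requires the partial geometric sum instead of its limit. *)
suff : - ((1 - q ^+ n) / (1 - q) ^+ 2) <= ln (\prod_(k < n) (1 - q ^+ k.+1)).
  apply: le_trans; rewrite lerN2 -exprVn ler_piMl ?exprn_ge0 ?invr_ge0 ?(ltW d0) //.
  by rewrite gerBl exprn_ge0 // ltW.
elim: n => [|n IHn]; first by rewrite big_ord0 ln1 expr0 subrr mul0r oppr0.
rewrite big_ord_recr /= lnM ?posrE ?prodr_gt0 //.
have := step (q ^+ n.+1) (exprn_ge0 _ (ltW q0)).
rewrite exprS ler_piMr ?(ltW q0) ?exprn_ile1 ?(ltW q0) ?(ltW q1) // => /(_ isT) h.
have qn : 0 <= q ^+ n by rewrite exprn_ge0 // ltW.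
have : - ((1 - q * q ^+ n) / (1 - q) ^+ 2) <=
       - ((1 - q ^+ n) / (1 - q) ^+ 2) - q * q ^+ n / (1 - q).
  rewrite -subr_ge0 [leRHS](_ : _ = q ^+ n / (1 - q) * (1 - q)).
    by rewrite !mulr_ge0 ?invr_ge0 // ltW.
  by field; lra.
by lra.
Qed.

(** * The two bounds *)

Lemma mallows_Z_prod (R : realType) (q : R) (n : nat) :
  mallows_Z n q * (1 - q) ^+ n = \prod_(k < n) (1 - q ^+ k.+1).
Proof.
elim: n => [|n IHn].
  rewrite big_ord0 mulr1 /mallows_Z (bigD1 1%g) //= big1 ?addr0.
    by rewrite inversionsE big_ord0.
  by move=> s /negP; case; apply/eqP/permP => -[].
rewrite big_ord_recr /= -IHn /mallows_Z mallows_sumS exprSr.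
have : 1 - q ^+ n.+1 = (1 - q) * \sum_(i < n.+1) q ^+ i.
  by rewrite -opprB subrX1 -mulNr opprB.
move=> ->; set A := \sum_(i < _) _; set B := \sum_(s : _) _.
by ring.
Qed.

(** Source of the room that makes both bounds of the theorem strict. *)
Lemma poly_gt0_near (R : realType) (p : {poly R}) (x : R) : 0 < p.[x] ->
  exists2 e, 0 < e & forall y, `|x - y| < e -> 0 < p.[y].
Proof.
move=> px; have := @continuous_horner _ p x => /cvgrPdist_lt /(_ _ px).
move=> /nbhs_ballP[e /= e0 eP]; exists e => // y xy.
have := eP y xy => /=; rewrite ltr_norml => /andP[_].
by lra.
Qed.

Section Bounds.
Variables (R : realType) (q : R).
Hypotheses (q_gt0 : 0 < q) (q_lt1 : q < 1).

Let d_gt0 : 0 < 1 - q. Proof. by rewrite subr_gt0. Qed.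
Let d2_gt0 : 0 < 1 - q ^+ 2. Proof. by rewrite subr_gt0 exprn_ilt1 // ltW. Qed.
Let d3_gt0 : 0 < 1 - q ^+ 3. Proof. by rewrite subr_gt0 exprn_ilt1 // ltW. Qed.

(* The terms of degree at most 3 of the q-Airy function [G] with
   [G y = G (q * y) - y * G (q * (q * y))]. *)
Definition airy3 (y : R) : R :=
  1 - y / (1 - q) + q ^+ 2 * y ^+ 2 / ((1 - q) * (1 - q ^+ 2)) -
  q ^+ 6 * y ^+ 3 / ((1 - q) * (1 - q ^+ 2) * (1 - q ^+ 3)).

(** Truncation leaves a single term in the functional equation, of degree 4 and nonnegative. *)
Lemma airy3_subsolution y : 0 <= y ->
  airy3 y <= airy3 (q * y) - y * airy3 (q * (q * y)).
Proof.
move=> y0; rewrite -subr_ge0 [leRHS](_ : _ =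
  q ^+ 12 * y ^+ 4 / ((1 - q) * (1 - q ^+ 2) * (1 - q ^+ 3))).
  by rewrite divr_ge0 ?mulr_ge0 ?exprn_ge0 // ltW.
by rewrite /airy3; field; rewrite !gt_eqF.
Qed.

Definition upper_root : R :=
  2 * q ^+ 2 * (q ^+ 2 + 1) * (1 - q) /
    (1 - Num.sqrt (1 - 4 * (1 - q) * q ^+ 2 * (q ^+ 2 + 1))).

Definition lower_root : R :=
  2 * q ^+ 2 * (1 - q) * (1 - q ^+ 3) /
    (1 - q ^+ 4 - Num.sqrt ((1 - q ^+ 4) ^+ 2 - 4 * q ^+ 2 * (1 - q) * (1 - q ^+ 3))).

(** Places [(1 + q + q ^+ 2)^-1] strictly between the roots of [X^2 - X + (1 - q) q^2 (q^2 + 1)].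
    After clearing denominators, the expression is [- q] times a sum of squares plus [q ^+ 7]. *)
Lemma upper_root_key :
  (1 + q + q ^+ 2)^-1 ^+ 2 - (1 + q + q ^+ 2)^-1 +
    (1 - q) * q ^+ 2 * (q ^+ 2 + 1) < 0.
Proof.
have s0 : 0 < 1 + q + q ^+ 2 by rewrite !addr_gt0 ?exprn_gt0.
rewrite -(pmulr_llt0 _ (exprn_gt0 2 s0)).
rewrite [ltLHS](_ : _ = - q * (2 * (q ^+ 3 - 2^-1) ^+ 2 + (q ^+ 4 - 2^-1) ^+ 2 +
  (q ^+ 2 - 2^-1) ^+ 2 + q ^+ 7)); last by field; rewrite gt_eqF.
rewrite nmulr_rlt0 ?oppr_lt0 // ltr_wpDl ?exprn_gt0 //.
have := (sqr_ge0 (q ^+ 3 - 2^-1), sqr_ge0 (q ^+ 4 - 2^-1), sqr_ge0 (q ^+ 2 - 2^-1)).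
by case=> -[]; lra.
Qed.

(** Rationalizing the denominator turns [upper_root] into [(1 + r) / 2], the larger root of the
    quadratic. The last clause amounts to [(1 - q) / upper_root < 1 - q ^+ 3]. *)
Lemma upper_rootP :
  [/\ 2^-1 <= upper_root,
      upper_root * (1 - upper_root) = (1 - q) * q ^+ 2 * (q ^+ 2 + 1) &
      (1 + q + q ^+ 2)^-1 < upper_root].
Proof.
have key := upper_root_key.
have a0 : 0 < (1 - q) * q ^+ 2 * (q ^+ 2 + 1).
  by rewrite !mulr_gt0 ?exprn_gt0 // addr_gt0 ?exprn_gt0.
rewrite /upper_root; set s := (1 + q + q ^+ 2)^-1 in key *.
set D := 1 - _ * _; have DE : D = 1 - 4 * ((1 - q) * q ^+ 2 * (q ^+ 2 + 1)).
  by rewrite /D; ring.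
set a := (1 - q) * q ^+ 2 * (q ^+ 2 + 1) in DE a0 key *.
have -> : 2 * q ^+ 2 * (q ^+ 2 + 1) * (1 - q) = 2 * a by rewrite /a; ring.
(* By [key], [a < s - s ^+ 2 <= 1 / 4]. *)
have D0 : 0 < D by rewrite DE; have := sqr_ge0 (s - 2^-1); lra.
have r0 := sqrtr_ge0 D; have r2 : Num.sqrt D ^+ 2 = D by rewrite sqr_sqrtr // ltW.
set r := Num.sqrt D in r0 r2 *.
have r1 : r < 1.
  rewrite ltNge; apply/negP => r1.
  have : 1 <= r ^+ 2 by rewrite exprn_ege1.
  by lra.
have -> : 2 * a / (1 - r) = (1 + r) / 2.
  have -> : a = (1 - r ^+ 2) / 4 by rewrite r2 DE; field.
  by field; lra.
have ra : r ^+ 2 = 1 - 4 * a by rewrite r2 DE.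
split; [by lra | by lra |].
rewrite ltNge; apply/negP => us.
have : 0 <= (s - (1 + r) / 2) * (s - (1 - r) / 2) by rewrite mulr_ge0 //; lra.
by lra.
Qed.

(* On this range [airy3] exceeds the quadratic whose roots are
   [(1 - q) / upper_root] and [(1 - q) / (1 - upper_root)], since [y < 1 - q ^+ 3]. *)
Lemma airy3_gt0 y : 0 <= y -> y <= (1 - q) / upper_root -> 0 < airy3 y.
Proof.
have [U2 UU Us] := upper_rootP; set U := upper_root in U2 UU Us *.
have U0 : 0 < U by lra.
have s0 : 0 < 1 + q + q ^+ 2 by rewrite !addr_gt0 ?exprn_gt0.
move=> y0 yU.
have Uy : U * y <= 1 - q by rewrite mulrC -ler_pdivlMr.
have y3 : y < 1 - q ^+ 3.
  apply: (le_lt_trans yU); rewrite ltr_pdivrMr //.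
  have -> : 1 - q ^+ 3 = (1 - q) * (1 + q + q ^+ 2) by ring.
  rewrite -mulrA ltr_pMr //.
  by rewrite -(ltr_pM2l s0) mulfV ?gt_eqF // in Us.
have [->|yn0] := eqVneq y 0; first by rewrite /airy3 !expr0n /= !mulr0 !mul0r; lra.
have ypos : 0 < y by rewrite lt_def yn0.
have -> : airy3 y = (1 - U * y / (1 - q)) * (1 - (1 - U) * y / (1 - q)) +
   q ^+ 6 * y ^+ 2 / ((1 - q) * (1 - q ^+ 2)) * ((1 - q ^+ 3 - y) / (1 - q ^+ 3)).
  have -> : (1 - U * y / (1 - q)) * (1 - (1 - U) * y / (1 - q)) =
     1 - y / (1 - q) + U * (1 - U) * y ^+ 2 / (1 - q) ^+ 2 by field; rewrite gt_eqF.
  by rewrite UU /airy3; field; rewrite !gt_eqF.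
have h (z : R) : z <= 1 - q -> 0 <= 1 - z / (1 - q).
  by move=> ?; rewrite subr_ge0 ler_pdivrMr // mul1r.
rewrite ltr_wpDl //; last first.
  by rewrite mulr_gt0 ?divr_gt0 ?mulr_gt0 ?exprn_gt0 // subr_gt0.
rewrite mulr_ge0 ?h //; apply: le_trans Uy.
by rewrite ler_wpM2r //; lra.
Qed.

(** Continuity at [x0] gains [e / 2]; a point [q ^+ k * x] then lies either in the range of
    [airy3_gt0] or within [e] of [x0]. *)
Lemma airy3_gt0_beyond :
  exists2 x, (1 - q) / upper_root < x & forall k, 0 < airy3 (q ^+ k * x).
Proof.
have [U2 _ _] := upper_rootP.
set x0 := (1 - q) / upper_root.
have x00 : 0 < x0 by rewrite divr_gt0 //; lra.
pose p := Poly [:: 1; - (1 - q)^-1; q ^+ 2 / ((1 - q) * (1 - q ^+ 2));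
  - (q ^+ 6 / ((1 - q) * (1 - q ^+ 2) * (1 - q ^+ 3)))].
have pE y : p.[y] = airy3 y.
  by rewrite horner_Poly /= /airy3; field; rewrite !gt_eqF.
have := airy3_gt0 (ltW x00) (lexx _); rewrite -/x0 -pE.
move=> /poly_gt0_near[e e0 eP]; exists (x0 + e / 2); first by lra.
move=> k; set y := q ^+ k * _.
have qk : 0 < q ^+ k by rewrite exprn_gt0.
have qk1 : q ^+ k <= 1 by rewrite exprn_ile1 // ltW.
have y0 : 0 <= y by rewrite mulr_ge0 //; lra.
have yx : y <= x0 + e / 2 by rewrite ler_piMl //; lra.
have [yx0|x0y] := leP y x0; first exact: airy3_gt0.
by rewrite -pE; apply: eP; rewrite ltr_norml; lra.
Qed.

Lemma lower_rootP :
  0 < lower_root /\ lower_root ^+ 2 =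
    (1 - q ^+ 4) * lower_root - q ^+ 2 * (1 - q) * (1 - q ^+ 3).
Proof.
have c0 : 0 < 1 - q ^+ 4 by rewrite subr_gt0 exprn_ilt1 // ltW.
have b0 : 0 < q ^+ 2 * (1 - q) * (1 - q ^+ 3) by rewrite !mulr_gt0 ?exprn_gt0.
rewrite /lower_root.
have D0 : 0 < (1 - q ^+ 4) ^+ 2 - 4 * q ^+ 2 * (1 - q) * (1 - q ^+ 3).
  rewrite [ltRHS](_ : _ = (1 - q) ^+ 2 *
    ((1 - q ^+ 2) + q * (1 - q ^+ 3) + q + 2 * q ^+ 5 + q ^+ 6)); last by ring.
  rewrite mulr_gt0 ?exprn_gt0 //.
  have q3 : 0 < q * (1 - q ^+ 3) by rewrite mulr_gt0.
  have q5 : 0 < 2 * q ^+ 5 by rewrite mulr_gt0 ?exprn_gt0.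
  have q6 : 0 < q ^+ 6 by rewrite exprn_gt0.
  by do 4 apply: addr_gt0 => //.
set D := _ - _ * _ * _ * _ in D0 *.
have DE : D = (1 - q ^+ 4) ^+ 2 - 4 * (q ^+ 2 * (1 - q) * (1 - q ^+ 3)).
  by rewrite /D; ring.
have -> : 2 * q ^+ 2 * (1 - q) * (1 - q ^+ 3) =
  2 * (q ^+ 2 * (1 - q) * (1 - q ^+ 3)) by ring.
set b := q ^+ 2 * _ * _ in b0 DE *; set c := 1 - q ^+ 4 in c0 DE *.
have r0 := sqrtr_ge0 D; have r2 : Num.sqrt D ^+ 2 = D by rewrite sqr_sqrtr // ltW.
set r := Num.sqrt D in r0 r2 *.
have rc : r < c by rewrite -ltr_sqr ?nnegrE ?(ltW c0) // r2 DE; lra.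
have -> : 2 * b / (c - r) = (c + r) / 2.
  have -> : b = (c ^+ 2 - r ^+ 2) / 4 by rewrite r2 DE; field.
  by field; lra.
split; first lra.
have -> : b = (c ^+ 2 - r ^+ 2) / 4 by rewrite r2 DE; field.
by field.
Qed.

(** * Lower bound through a finite continued fraction *)

Variable a : nat -> R.
Hypothesis a0 : a 0 = 1.
Hypothesis aS : forall n, a n.+1 = \sum_(i < n.+1) q ^+ i * (a i * a (n - i)%N).

(** Otherwise [A] converges at [q * x] with [x * A(q * x) <= 1], and unrolling the functional
    inequality three times contradicts the vanishing of the continued fraction at [x]. *)
Lemma renewal_exceeds : exists K : nat,
  1 < \sum_(k < K) q ^+ k * a k * ((1 - q) / lower_root) ^+ k.+1.
Proof.
have [V0 VE] := lower_rootP; set V := lower_root in V0 VE *.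
set x := (1 - q) / V.
have x0 : 0 < x by rewrite divr_gt0.
(* The numerator of the continued fraction vanishes at [x]: this is the quadratic of [lower_rootP]
   with [V = (1 - q) / x]. *)
have T0 : 1 - (1 + q + q ^+ 2 + q ^+ 3) * x + (q ^+ 2 + q ^+ 3 + q ^+ 4) * x ^+ 2 = 0.
  have : (V ^+ 2 - ((1 - q ^+ 4) * V - q ^+ 2 * (1 - q) * (1 - q ^+ 3))) / V ^+ 2 = 0.
    by rewrite VE subrr mul0r.
  by move=> <-; rewrite /x; field; rewrite gt_eqF.
have SE K : \sum_(k < K) q ^+ k * a k * x ^+ k.+1 = x * psum a K (q * x).
  rewrite /psum big_distrr /=; apply: eq_bigr => k _.
  by rewrite [(q * x) ^+ k]exprMn exprS; ring.
apply: contrapT => noK.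
have bnd N : psum a N (q * x) <= x^-1.
  rewrite -[leRHS]mul1r ler_pdivlMr // mulrC -SE leNgt; apply/negP => h.
  by apply: noK; exists N.
have bndq y B : 0 <= y -> (forall N, psum a N y <= B) -> forall N, psum a N (q * y) <= B.
  move=> y0 yB N; apply: le_trans (yB N).
  apply: ler_sum => i _; rewrite ler_wpM2l ?(carlitz_ge0 q_gt0 a0 aS) //.
  by rewrite lerXn2r ?nnegrE ?mulr_ge0 ?(ltW q_gt0) // ler_piMl // ltW.
pose x1 := q * x; pose x2 := q * x1; pose x3 := q * x2; pose x4 := q * x3.
have x10 : 0 < x1 by rewrite mulr_gt0.
have x20 : 0 < x2 by rewrite mulr_gt0.
have x30 : 0 < x3 by rewrite mulr_gt0.
have x40 : 0 < x4 by rewrite mulr_gt0.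
have b2 := bndq _ _ (ltW x10) bnd; have b3 := bndq _ _ (ltW x20) b2.
have b4 := bndq _ _ (ltW x30) b3.
have g1 := genseries_ge q_gt0 q_lt1 a0 aS (ltW x10) bnd.
have g2 := genseries_ge q_gt0 q_lt1 a0 aS (ltW x20) b2.
have g3 := genseries_ge q_gt0 q_lt1 a0 aS (ltW x30) b3.
(* Strictness enters at the innermost level, from the linear term [a 1 * x4 > 0]. *)
have g4 : 1 < genseries a x4.
  apply: lt_le_trans (genseries_ge_psum q_gt0 a0 aS 2 (ltW x40) b4).
  rewrite /psum !big_ord_recl big_ord0 a0 expr0 mul1r addr0 ltrDl /= mulr_gt0 //.
  exact: lt_le_trans ltr01 (carlitz_ge1 q_gt0 a0 aS 1).
have gx : x * genseries a x1 <= 1.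
  rewrite mulrC -ler_pdivlMr // div1r; apply: limr_le.
    exact: (cvg_psum q_gt0 a0 aS (ltW x10) bnd).
  by near=> N; exact: bnd.
have ge1 y B : 0 <= y -> (forall N, psum a N y <= B) -> 1 <= genseries a y.
  move=> y0 yB; apply: le_trans (genseries_ge_psum q_gt0 a0 aS 1 y0 yB).
  by rewrite /psum big_ord1 a0 expr0 mulr1.
have A1 := ge1 _ _ (ltW x10) bnd; have A2 := ge1 _ _ (ltW x20) b2.
have A3 := ge1 _ _ (ltW x30) b3.
rewrite -/x2 in g1; rewrite -/x3 in g2; rewrite -/x4 in g3.
move: (genseries a x1) (genseries a x2) (genseries a x3) (genseries a x4)
  A1 A2 A3 g1 g2 g3 g4 gx
  => A1 A2 A3 A4 A1_ge1 A2_ge1 A3_ge1 g1 g2 g3 g4 gx.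
(* If [A >= 1 / (1 - y * B)] and [B > e / d] then [A > d / (d - y * e)]: one level
   of the continued fraction. *)
have step (A B d e y : R) : 0 < y -> 1 <= A -> 0 < d ->
    e < d * B -> 1 + y * (B * A) <= A -> d < (d - y * e) * A.
  move=> y0 A_ge1 d0 h1 h2.
  have : d * (1 + y * (B * A)) <= d * A by rewrite ler_pM2l.
  have : y * A * e < y * A * (d * B) by rewrite ltr_pM2l // mulr_gt0 //; lra.
  lra.
have t3 : 1 < (1 - x3) * A3.
  by have := step A3 A4 1 1 x3 x30 A3_ge1 ltr01; rewrite mulr1; apply=> //; rewrite mul1r.
have pos (d A : R) : 0 < d * A -> 1 <= A -> 0 < d.
  by move=> dA hA; rewrite pmulr_lgt0 in dA => //; lra.
have d3 : 0 < 1 - x3 by apply: (pos _ A3) => //; lra.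
have t2 := step A2 A3 _ _ x2 x20 A2_ge1 d3 t3 g2; rewrite mulr1 in t2.
have d2 : 0 < 1 - x3 - x2 by apply: (pos _ A2) => //; lra.
have t1 := step A1 A2 _ _ x1 x10 A1_ge1 d2 t2 g1.
have d1 : 0 < 1 - x3 - x2 - x1 * (1 - x3) by apply: (pos _ A1) => //; lra.
(* With [d2] and [d1] the last two denominators, [x * d2 < d1 * (x * A1) <= d1], whereas [T0] says
   [d1 = x * d2]. *)
have : x * (1 - x3 - x2) < x * ((1 - x3 - x2 - x1 * (1 - x3)) * A1) by rewrite ltr_pM2l.
have : (1 - x3 - x2 - x1 * (1 - x3)) * (x * A1) <= (1 - x3 - x2 - x1 * (1 - x3)) * 1.
  by rewrite ler_pM2l.
rewrite /x3 /x2 /x1 in T0 *.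
by lra.
Unshelve. all: by end_near. Qed.

(** The sum exceeds 1 strictly at [(1 - q) / lower_root], so by continuity it still does at a
    slightly smaller [x], for which [(1 - q) / x] is strictly above [lower_root]. *)
Lemma renewal_before :
  exists K : nat, exists x, [/\ 0 < x, x < (1 - q) / lower_root &
    1 <= \sum_(k < K) q ^+ k * a k * x ^+ k.+1].
Proof.
have [V0 _] := lower_rootP.
have [K hK] := renewal_exceeds; exists K.
set x0 := (1 - q) / lower_root in hK *.
have x00 : 0 < x0 by rewrite divr_gt0.
pose p : {poly R} := (\sum_(k < K) (q ^+ k * a k)%:P * 'X ^+ k.+1) - 1%:P.
have pE y : p.[y] = \sum_(k < K) q ^+ k * a k * y ^+ k.+1 - 1.
  rewrite /p hornerD hornerN hornerC horner_sum; congr (_ - _).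
  by apply: eq_bigr => k _; rewrite hornerM hornerC hornerXn.
have : 0 < p.[x0] by rewrite pE subr_gt0.
move=> /poly_gt0_near[e e0 eP].
pose m := Num.min e x0.
have m0 : 0 < m by rewrite lt_min e0.
have me : m <= e by rewrite ge_min lexx.
have mx : m <= x0 by rewrite ge_min lexx orbT.
exists (x0 - m / 2); split; try lra.
have := eP (x0 - m / 2); rewrite pE opprB addrC subrK gtr0_norm; last by lra.
by move=> h; have := h ltac:(lra); lra.
Qed.

End Bounds.

Unset Implicit Arguments.

Theorem theorem4 (R : realType) (q : R) (tau : 'S_3) :
  0 < q -> q < 1 ->
  tau = perm312 \/ tau = perm231 ->
  let u : R^nat := fun n => mallows q (avoiders n tau) `^ (n%:R)^-1 in
  [/\ cvgn u,
      2 * q ^+ 2 * (1 - q) * (1 - q ^+ 3) /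
        (1 - q ^+ 4 -
         Num.sqrt ((1 - q ^+ 4) ^+ 2 -
                   4 * q ^+ 2 * (1 - q) * (1 - q ^+ 3)))
      < limn u
    & limn u <
      2 * q ^+ 2 * (q ^+ 2 + 1) * (1 - q) /
        (1 - Num.sqrt (1 - 4 * (1 - q) * q ^+ 2 * (q ^+ 2 + 1)))].
Proof.
move=> q0 q1 tauE u.
pose a := avoid_weight q; have a0 : a 0 = 1 := avoid_weight0 q.
have aS n : a n.+1 = \sum_(i < n.+1) q ^+ i * (a i * a (n - i)%N) := avoid_weightS q n.
(* Scaling numerator and denominator of the Mallows probability by [(1 - q) ^+ n] turns [mallows_Z]
   into the product [D n], whose logarithm is bounded. *)
pose v n := a n * (1 - q) ^+ n.
pose D n : R := \prod_(k < n) (1 - q ^+ k.+1).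
have d0 : 0 < 1 - q by rewrite subr_gt0.
have qk k : 0 < 1 - q ^+ k.+1 <= 1.
  by rewrite subr_gt0 exprn_ilt1 ?(ltW q0) //= gerBl exprn_ge0 // ltW.
have D01 n : 0 < D n <= 1.
  rewrite /D prodr_gt0 => [|k _]; last by case/andP: (qk k).
  by apply: prodr_ile1 => k _; case/andP: (qk k) => /ltW ->.
have uE : u = fun n => (v n / D n) `^ (n%:R)^-1.
  apply/funext => n; rewrite /u; congr (_ `^ _).
  rewrite /D -mallows_Z_prod /v /a invfM mulrACA divff ?mulr1 ?expf_neq0 ?gt_eqF //.
  by rewrite /mallows -mulr_suml; case: tauE => ->; rewrite ?avoid_weight231.
have ge1 := carlitz_ge1 q0 a0 aS.
have v0 n : 0 < v n by rewrite mulr_gt0 ?exprn_gt0 // (lt_le_trans ltr01).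
have vM m n : v m * v n <= v (m + n)%N.
  rewrite /v mulrACA -exprD ler_wpM2r ?exprn_ge0 ?(ltW d0) //.
  exact: (carlitz_supermul q0 a0 aS).
have vB x B : 0 < x -> (forall n, a n * x ^+ n <= B) ->
    forall n, v n <= B * ((1 - q) / x) ^+ n.
  move=> x0 aB n; rewrite expr_div_n mulrA ler_pdivlMr ?exprn_gt0 // /v mulrAC.
  by rewrite ler_wpM2r // exprn_ge0 // ltW.
have [U2 _ _] := upper_rootP q0 q1; have [V0 _] := lower_rootP q0 q1.
have U0 : 0 < upper_root q by apply: lt_le_trans U2.
have [x xU Hx] := airy3_gt0_beyond q0 q1.
have x0 : 0 < x by apply: lt_trans xU; rewrite divr_gt0.
have aB := carlitz_le_of_supersolution q0 a0 aS (ltW x0) Hx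
  (fun y => @airy3_subsolution _ _ q0 q1 y).
set B := _ / _ in aB; have B0 : 0 < B by apply: lt_le_trans (aB 0); rewrite a0 mulr1.
have rx : 0 < (1 - q) / x by rewrite divr_gt0.
have [l [l0 ul vl lmin]] := supermultiplicative_root_cvg v0 vM B0 rx
  (vB _ _ x0 aB) D01 (fun n => ln_qpochhammer_ge n q0 q1).
have -> : limn u = l by rewrite uE; exact: cvg_lim.
split; first by rewrite uE.
  have [K [y [y0 yV hK]]] := renewal_before q0 q1 a0 aS.
  have [c c0 ca] := carlitz_ge_of_renewal q0 a0 aS y0 hK.
  rewrite -/(lower_root q).
  apply: (@lt_le_trans _ _ ((1 - q) / y)).
    by rewrite (ltr_pdivlMr _ _ y0) mulrC -(ltr_pdivlMr _ _ V0).
  apply: (le_of_exp_bound (c := c)) => // [|n]; first by rewrite divr_gt0.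
  apply: le_trans (vl n); rewrite expr_div_n mulrA ler_pdivrMr ?exprn_gt0 //.
  by rewrite /v mulrAC ler_wpM2r // exprn_ge0 // ltW.
rewrite -/(upper_root q).
(* The limit is at most [(1 - q) / x], and [x] lies strictly beyond [(1 - q) / upper_root q]. *)
apply: (le_lt_trans (lmin _ _ rx B0 (vB _ _ x0 aB))).
by rewrite (ltr_pdivrMr _ _ x0) mulrC -(ltr_pdivrMr _ _ U0).
Qed.
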